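(* Let $\delta$ be a complex number such that $|\delta|>1$ and let $A$ be a finite non-empty set (alphabet) of complex numbers. Then the following assertions are equivalent. (1) The set $Z(\delta,A)$ is accepted by a finite Büchi automaton. (2) The right congruence $\sim_{\delta,A}$ has finitely many classes. (3) The spectrum $X^A(\delta)$ has no accumulation point in $\mathbb{C}$. (4) The zero automaton $\mathcal{Z}(\delta,A)$ is finite.
   Context: $\mathbb N=\{0,1,2,\dots\}$. $A^*$ is the set of finite words over $A$ (including the empty word) and $A^{\mathbb N}$ the set of infinite words $a=a_0a_1a_2\cdots$ over $A$. The set of $\delta$-representations of zero over $A$ is $Z(\delta,A)=\{a\in A^{\mathbb N} : \sum_{n=0}^{+\infty}\frac{a_n}{\delta^{n+1}}=0\}$. The spectrum of $\delta$ over $A$ is $X^A(\delta)=\{\sum_{n=0}^{\ell-1}a_n\delta^{\ell-1-n} : \ell\in\mathbb N,\ a_0,\ldots,a_{\ell-1}\in A\}$ (the empty sum, for $\ell=0$, is $0$). The right congruence $\sim_{\delta,A}$ on $A^*$ is defined by: $a\sim_{\delta,A}b$ if and only if for all $s\in A^{\mathbb N}$, $as\in Z(\delta,A)\iff bs\in Z(\delta,A)$. A Büchi automaton is a quintuple $(Q,I,F,B,E)$ with a set of states $Q$, initial states $I\subseteq Q$, final states $F\subseteq Q$, a finite alphabet $B$ and transitions $E\subseteq Q\times B\times Q$ (it need not be deterministic). It is finite if $Q$ is finite. An infinite word over $B$ is accepted if it labels an infinite path that starts in an initial state and visits final states infinitely many times. The set accepted by the automaton is the set of all infinite words it accepts.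 The zero automaton $\mathcal Z(\delta,A)=(Q,0,Q,A,E)$ is the Büchi automaton with set of states $Q=X^A(\delta)\cap\{z\in\mathbb C : |z|\le\frac{M}{|\delta|-1}\}$ where $M=\max\{|a| : a\in A\}$, with initial state $0$, all states final, and whose transitions are the triplets $(z,a,z\delta+a)$ in $Q\times A\times Q$. *)

(* Defs.v *)
From HB Require Import structures.
From mathcomp Require Export all_boot all_order all_algebra.
From mathcomp Require Export finmap.
From mathcomp Require Export all_classical all_reals all_analysis.
From mathcomp Require Export complex.
Set Implicit Arguments.
Unset Strict Implicit.
Unset Printing Implicit Defensive.
Import Order.TTheory GRing.Theory Num.Theory.
Import numFieldNormedType.Exports.

Local Open Scope classical_set_scope.
Local Open Scope ring_scope.

Section words.
Variable L : choiceType.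

Definition fin_words (A : {fset L}) : set (seq L) :=
  [set w : seq L | {subset w <= A}].

Definition inf_words (A : {fset L}) : set (nat -> L) :=
  [set s | forall n, s n \in A].

(* The infinite word w s; the default value of nth is never used. *)
Definition wcat (w : seq L) (s : nat -> L) : nat -> L :=
  fun n => if (n < size w)%N then nth (s 0%N) w n else s (n - size w)%N.

(* The set of states Q is the whole type [state]. *)
Record buchi := Buchi {
  state : Type;
  initial : set state;
  final : set state;
  alphabet : {fset L};
  transition : set (state * L * state);
  transition_alphabet :
    forall p x q, transition (p, x, q) -> x \in alphabet }.

Definition finite_buchi (M : buchi) : Prop := finite_set [set: state M].

Definition accepts (M : buchi) (s : nat -> L) : Prop :=
  exists p : nat -> state M,
    [/\ initial (p 0%N),
        forall n, transition (p n, s n, p n.+1) &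
        infinite_set [set n | final (p n)]].

Definition accepted_set (M : buchi) : set (nat -> L) := [set s | accepts M s].

End words.

(* The complex numbers are the case K = R[i] for R : realType, where the norm
   of a numFieldType is the modulus and its topology the one of the modulus. *)
Section zero_representations.
Variables (K : numFieldType) (delta : K) (A : {fset K}).

Definition zero_reps : set (nat -> K) :=
  [set a | inf_words A a /\
     series (fun n => a n / delta ^+ n.+1) @ \oo --> (0 : K)].

Definition spectrum : set K :=
  [set \sum_(n < size w) w`_n * delta ^+ (size w - 1 - n) | w in fin_words A].

Definition right_congr (a b : seq K) : Prop :=
  forall s, inf_words A s ->
    (zero_reps (wcat a s) <-> zero_reps (wcat b s)).

Definition right_congr_classes : set (set (seq K)) :=
  [set [set b | fin_words A b /\ right_congr a b] | a in fin_words A].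

(* Moduli are nonnegative, hence pairwise comparable even in K = R[i], so that
   Num.max computes the largest one. *)
Definition max_modulus : K := \big[Num.max/0]_(a <- A) `|a|.

Definition zero_states : set K :=
  spectrum `&` [set z | `|z| <= max_modulus / (`|delta| - 1)].

Definition zero_transition : set (zero_states * K * zero_states) :=
  [set t | t.1.2 \in A /\ set_val t.2 = set_val t.1.1 * delta + t.1.2].

Lemma zero_transition_alphabet p x q :
  zero_transition (p, x, q) -> x \in A.
Proof. by case. Qed.

Definition zero_automaton : buchi K :=
  @Buchi K zero_states [set z | set_val z = 0] setT A zero_transition
    zero_transition_alphabet.

End zero_representations.

(* Main.v *)
Require Import Defs.
From mathcomp Require Import ring lra.
Import Order.TTheory GRing.Theory Num.Theory.
Import numFieldNormedType.Exports.
Local Open Scope classical_set_scope.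
Local Open Scope ring_scope.
Set Implicit Arguments.
Unset Strict Implicit.
Unset Printing Implicit Defensive.

(** Reading a word [w] from a number [y] with the rule [z |-> z * delta + x]
    leads to [value y w]; the spectrum consists of the values of finite words
    from [0].  Since [value y] of the prefix of length [n] of [s] is
    [delta ^+ n] times [y] plus the [n]-th partial sum of [s] ([value_series]),
    the word [s] represents [- y] exactly when these values stay bounded, and
    then they stay in the disc of radius [M / (`|delta| - 1)], where [M] is the
    largest modulus of a letter, because no trajectory re-enters this disc once
    it has left it ([bounded_trajectory_cvg], [cvg_cancels]).  Call [y]
    cancellable if some infinite word over [A] represents [- y].

    (1) => (2).  After a finite word, acceptance of the rest depends only on
    the set of states reachable by that word, and there are finitely many
    such sets ([finite_right_congr_classes]).

    (2) => (3).  If [a] followed by [s] represents zero, then [s] determines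
    the value of [a], hence so does the class of [a]: only finitely many
    elements of the spectrum are cancellable ([finite_cancellable_values]).
    Non-cancellable elements are handled by Koenig's lemma: if [y] is not
    cancellable, only finitely many words have a value from [y] in a given
    disc, since otherwise the tree of these words would have an infinite
    branch, and such a branch is an infinite word representing [- y]
    ([finite_descendants_ball]).  Every non-cancellable element of the
    spectrum descends from [0] or from one of the finitely many successors of
    cancellable elements, the roots of the non-cancellable parts of the
    trajectories.  So every disc meets the spectrum in a finite set
    ([finite_spectrum_ball]), and there is no accumulation point.

    (3) => (4).  The states of the zero automaton are the points of the
    spectrum in a disc, so this is the Bolzano-Weierstrass theorem
    ([finite_ball]).

    (4) => (1).  The runs of the zero automaton are the trajectories that
    start at [0] and stay in the disc, so it accepts exactly the
    representations of zero ([accepted_set_zero_automaton]). *)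

(** * Finite and infinite words *)

Section words.
Variable L : choiceType.
Implicit Types (A : {fset L}) (w : seq L) (s : nat -> L).

Lemma mkseq_wcat w s n : mkseq (wcat w s) (size w + n) = w ++ mkseq s n.
Proof.
apply: (@eq_from_nth _ (s 0%N)); first by rewrite size_cat !size_mkseq.
move=> i; rewrite size_mkseq => ilt.
rewrite nth_mkseq// nth_cat /wcat; case: ltnP => // wi.
by rewrite nth_mkseq// ltn_subLR.
Qed.

Lemma wcat_nil s : wcat [::] s = s.
Proof. by apply/funext => n; rewrite /wcat /= subn0. Qed.

Lemma wcat_cons x w s : wcat (x :: w) s = wcat [:: x] (wcat w s).
Proof. by apply/funext => -[|n]; rewrite /wcat //= ltnS subSS subn1. Qed.

Lemma inf_words_wcat A w s :
  fin_words A w -> inf_words A s -> inf_words A (wcat w s).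
Proof.
move=> wA sA n; rewrite /wcat; case: ltnP => [/(mem_nth (s 0%N))/wA //|_].
exact: sA.
Qed.

Lemma fin_words_mkseq A s n : inf_words A s -> fin_words A (mkseq s n).
Proof. by move=> sA x /mapP[i _ ->]. Qed.

Lemma fin_words_cons A x w : fin_words A (x :: w) <-> x \in A /\ fin_words A w.
Proof.
split=> [wA|[xA wA] y]; last by rewrite inE => /orP[/eqP->|/wA].
by split=> [|y yw]; apply: wA; rewrite inE ?eqxx ?yw ?orbT.
Qed.

Lemma finite_fin_words_size A n :
  finite_set [set w | fin_words A w /\ (size w <= n)%N].
Proof.
elim: n => [|n IH].
  by apply: (sub_finite_set _ (finite_set1 [::])) => w [_ /=]; case: w.
have fA : finite_set [set x | x \in A] by apply: finite_fset.
have fin : finite_set ([set [::]] `|` image2 [set` A]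
    [set w | fin_words A w /\ (size w <= n)%N] cons).
  by rewrite finite_setU; split; [exact: finite_set1 | exact: finite_image2].
apply: sub_finite_set fin => -[|x w] [wA sw]; first by left.
by right; have [xA wA'] := (fin_words_cons A x w).1 wA; exists x => //; exists w.
Qed.

End words.

(** * Finite sets *)

(** If [g] has finitely many values on [D] and determines [h] there, then [h]
    factors through [g], by a choice of a preimage for each value of [g]. *)
Lemma finite_factor (T U V : Type) (D : set T) (g : T -> U) (h : T -> V) :
  (forall a b, D a -> D b -> g a = g b -> h a = h b) ->
  finite_set (g @` D) -> finite_set (h @` D).
Proof.
move=> gh fD.
have [->|/set0P[a0 Da0]] := eqVneq D set0; first by rewrite image_set0.
have /choice[k kP] : forall u, exists a, (g @` D) u -> D a /\ g a = u.
  by move=> u; have [[a Da <-]|nu] := pselect ((g @` D) u); [exists a|exists a0].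
have := finite_image (h \o k) fD; apply: sub_finite_set => _ [a Da <-].
have gDa : (g @` D) (g a) by exists a.
have [Dk gk] := kP _ gDa.
by exists (g a) => //=; apply: gh.
Qed.

(** A bijection of [Q] with an initial segment of the natural numbers codes the
    subsets of [Q] by elements of a finite type; this also covers a [Q] that is
    a bare type, without decidable equality. *)
Lemma finite_set_of_sets (Q : Type) :
  finite_set [set: Q] -> finite_set [set: set Q].
Proof.
move=> /finite_setP[n /pcard_eqP/unsquash f].
pose code (S : set Q) : {set 'I_n} :=
  finset (fun i : 'I_n => `[< exists2 q, S q & f q = i >]).
have code_sub S1 S2 : code S1 = code S2 -> S1 `<=` S2.
  move=> /setP e q Sq; have fq : (f q < n)%N by have := @funS _ _ _ _ f q I.
  have := e (Ordinal fq); rewrite !inE => {}e.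
  have : `[< exists2 q, S2 q & f q = Ordinal fq >].
    by rewrite -e; apply/asboolP; exists q.
  by move=> /asboolP[q' Sq' /= /(@inj _ _ _ f _ _ (mem_set I) (mem_set I)) <-].
have -> : [set: set Q] = code @^-1` setT by [].
apply: finite_preimage; last exact: finite_finset.
by move=> S1 S2 _ _ e; apply/seteqP; split; apply: code_sub.
Qed.

(** * Büchi acceptance and reachable sets of states *)

Section automata.
Variables (L : choiceType) (M : buchi L).
Implicit Types (S : set (state M)) (w : seq L) (s : nat -> L).

(** Starting from a set of states, not from a single one, lets a nondeterministic
    automaton be treated like its subset construction: reading a letter only
    changes the starting set. *)
Definition accepts_from S s :=
  exists p : nat -> state M,
    [/\ S (p 0%N),
        forall n, transition (p n, s n, p n.+1) &
        infinite_set [set n | final (p n)]].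

Definition successors S (x : L) : set (state M) :=
  [set q | exists2 p, S p & transition (p, x, q)].

(** A path loses or gains its first state, which changes the set of times of
    visits to final states by a shift and at most one element, so its
    infiniteness is preserved. *)
Lemma accepts_from_cons S x s :
  accepts_from S (wcat [:: x] s) <-> accepts_from (successors S x) s.
Proof.
have xs n : wcat [:: x] s n.+1 = s n by rewrite /wcat /= subn1.
split=> -[p [p0 pE pF]].
- exists (p \o succn); split=> [|n|] /=.
  + by exists (p 0%N) => //; apply: (pE 0%N).
  + by rewrite -xs; apply: pE.
  + apply: contra_not pF => fin; apply: (@sub_finite_set _ _ ([set 0%N] `|` succn @` [set n | final (p n.+1)])).
      by move=> -[|n] /= Fn; [left | right; exists n].
    by rewrite finite_setU; split; [exact: finite_set1 | exact: finite_image].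
- have [q Sq qE] := p0.
  exists (fun n => if n is n'.+1 then p n' else q); split=> [//|[|n]|] /=.
  + exact: qE.
  + by rewrite xs; apply: pE.
  + apply: contra_not pF => fin.
    have := @finite_preimage _ _ _ succn (in2W succn_inj) fin.
    exact: sub_finite_set.
Qed.

Lemma accepts_from_wcat S w s :
  accepts_from S (wcat w s) <-> accepts_from (foldl successors S w) s.
Proof.
elim: w S => [|x w IH] S /=; first by rewrite wcat_nil.
by rewrite wcat_cons accepts_from_cons IH.
Qed.

End automata.

(** * Trajectories of z |-> z * delta + x *)

Section trajectories.
Variables (K : numFieldType) (delta : K) (A : {fset K}).
Hypothesis (delta_gt1 : 1 < `|delta|).
(* a numeric field need not be archimedean, so this does not follow *)
Hypothesis (powers_small : forall e : K, 0 < e ->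
  exists N, forall n, (N <= n)%N -> `|delta ^- n| < e).
Implicit Types (x y z r : K) (w u v : seq K) (s : nat -> K).

Definition value y w := foldl (fun z x => z * delta + x) y w.

Let R0 := max_modulus A / (`|delta| - 1).

(** The bounded form of: [s] is a word over [A] that represents [- y]; the two
    are identified by [cancelsP]. *)
Definition cancels y s :=
  inf_words A s /\ forall n, `|value y (mkseq s n)| <= R0.

(** The order of [K] need not be total, so the usual lemmas on iterated maxima do
    not apply; all that matters is that moduli are comparable. *)
Lemma max_modulusP : 0 <= max_modulus A /\ {in A, forall x, `|x| <= max_modulus A}.
Proof.
suff : forall l : seq K, 0 <= \big[Num.max/0]_(a <- l) `|a| /\
    {in l, forall x, `|x| <= \big[Num.max/0]_(a <- l) `|a|}.
  exact.
elim=> [|a l [ge0 le]]; first by rewrite big_nil; split.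
rewrite big_cons; set m := \big[_/_]_(_ <- _) _ in ge0 le *.
have cmp : (`|a| >=< m)%O by rewrite real_comparable ?ger0_real.
split; first by rewrite comparable_le_max ?ge0 ?orbT.
move=> x; rewrite inE comparable_le_max// => /orP[/eqP->|/le->].
  by rewrite lexx.
by rewrite orbT.
Qed.

Lemma delta_neq0 : delta != 0.
Proof. by rewrite -normr_gt0; apply: lt_trans delta_gt1. Qed.

Lemma radius_ge0 : 0 <= R0.
Proof. by rewrite divr_ge0 ?subr_ge0 ?(ltW delta_gt1)// max_modulusP.1. Qed.

(** Outside a disc of radius [r >= R0] the multiplication by [delta] dominates any
    letter: a trajectory that leaves such a disc never comes back. *)
Lemma le_norm_step r z x :
  R0 <= r -> x \in A -> `|z * delta + x| <= r -> `|z| <= r.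
Proof.
move=> Rr xA zr.
have d0 : 0 < `|delta| by apply: lt_trans delta_gt1.
rewrite -(ler_pM2r d0).
have Mr : max_modulus A <= r * (`|delta| - 1).
  by rewrite -ler_pdivrMr ?subr_gt0.
have : `|z * delta + x| + `|x| <= r * `|delta|.
  apply: le_trans (lerD zr (le_trans (max_modulusP.2 _ xA) Mr)) _.
  by rewrite mulrBr mulr1 addrC subrK.
apply: le_trans; rewrite -normrM.
by rewrite -{1}(addrK x (z * delta)) ler_normB.
Qed.

Lemma le_norm_value r z w :
  R0 <= r -> fin_words A w -> `|value z w| <= r -> `|z| <= r.
Proof.
move=> Rr; elim: w z => [//|x w IH] z /fin_words_cons[xA wA] /=.
by move=> /(IH _ wA); apply: le_norm_step.
Qed.

Lemma value_cat y u v : value y (u ++ v) = value (value y u) v.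
Proof. exact: foldl_cat. Qed.

Lemma value_rcons y w x : value y (rcons w x) = value y w * delta + x.
Proof. by rewrite -cats1 value_cat. Qed.

Lemma value_mkseqS y s n :
  value y (mkseq s n.+1) = value y (mkseq s n) * delta + s n.
Proof. by rewrite /mkseq -addn1 iotaD map_cat value_cat. Qed.

Lemma value_series y s n :
  value y (mkseq s n) = delta ^+ n * (y + series (fun k => s k / delta ^+ k.+1) n).
Proof.
elim: n => [|n IH]; first by rewrite expr0 mul1r /series /= big_geq// addr0.
rewrite value_mkseqS IH /series /= big_nat_recr//= addrA [RHS]mulrDr.
rewrite [delta ^+ n.+1 * (s n / _)]mulrCA mulfV ?expf_neq0 ?delta_neq0// mulr1.
by rewrite exprSr mulrAC.
Qed.

(** By [value_series], the distance from the partial sum to [- y] is the modulus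
    of the value divided by a power of [`|delta|]. *)
Lemma bounded_trajectory_cvg r y s : (forall n, `|value y (mkseq s n)| <= r) ->
  series (fun k => s k / delta ^+ k.+1) @ \oo --> - y.
Proof.
move=> br; apply/cvgrPdist_lt => e e0.
have r0 : 0 <= r by apply: le_trans (br 0%N).
have er : 0 < e / (r + 1) by rewrite divr_gt0// ltr_wpDl.
have [N /= dN] := powers_small er; exists N => // n /= /dN dn.
rewrite -opprD normrN.
have -> : y + series (fun k => s k / delta ^+ k.+1) n =
    delta ^- n * value y (mkseq s n).
  by rewrite value_series mulrA mulVf ?mul1r// expf_neq0 ?delta_neq0.
rewrite normrM; apply: (le_lt_trans (y := `|delta ^- n| * (r + 1))).
  by rewrite ler_wpM2l// (le_trans (br n))// lerDl.
by rewrite -ltr_pdivlMr// ltr_wpDl.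
Qed.

(** If some value had modulus [R0 + g] with [g > 0], the later ones would exceed
    [R0] by at least [g] times the powers of [`|delta|]; divided by these powers
    they would not tend to [0], against [value_series]. *)
Lemma cvg_cancels y s : inf_words A s ->
  series (fun k => s k / delta ^+ k.+1) @ \oo --> - y -> cancels y s.
Proof.
move=> sA sy; split=> // n.
have d0 : 0 < `|delta| by apply: lt_trans delta_gt1.
have dn0 : 0 < `|delta| ^+ n by apply: exprn_gt0.
rewrite -subr_le0.
have real_gap z : `|z| - R0 \is Num.real by rewrite realB// ger0_real// radius_ge0.
rewrite real_leNgt//; apply/negP => gap.
set g := `|value y (mkseq s n)| - R0 in gap.
(* once outside the ball, the excess over its radius grows by |delta| *)
have grow k : g * `|delta| ^+ k <= `|value y (mkseq s (n + k))| - R0.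
  elim: k => [|k IH]; first by rewrite expr0 mulr1 addn0.
  rewrite addnS value_mkseqS exprSr mulrA.
  have := ler_wpM2r (ltW d0) IH => /le_trans; apply.
  have R0E : R0 * `|delta| = R0 + max_modulus A.
    have d1 : `|delta| - 1 != 0 by rewrite subr_eq0 gt_eqF.
    by rewrite /R0; field.
  rewrite mulrBl -normrM R0E opprD addrCA addrC lerD2r lerBlDr.
  apply: le_trans (lerD (lexx _) (max_modulusP.2 _ (sA (n + k)%N))).
  by rewrite -[X in `|X| <= _](addrK (s (n + k)%N)) ler_normB.
move/cvgrPdist_lt: sy => /(_ (g / `|delta| ^+ n) (divr_gt0 gap dn0)).
move=> [N _ /(_ (n + N)%N (leq_addl _ _))].
rewrite -opprD normrN ltr_pdivlMr// => small.
have := grow N; apply/negP; rewrite -real_ltNge ?real_gap ?realM ?realX ?gtr0_real//.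
apply: (le_lt_trans (y := `|value y (mkseq s (n + N))|)).
  by rewrite gerBl radius_ge0.
rewrite value_series normrM normrX exprD mulrAC mulrC [ltRHS]mulrC.
by rewrite ltr_pM2l ?exprn_gt0// mulrC.
Qed.

Lemma cancelsP y s : cancels y s <->
  inf_words A s /\ series (fun k => s k / delta ^+ k.+1) @ \oo --> - y.
Proof.
split=> -[sA sy]; first by split=> //; apply: bounded_trajectory_cvg sy.
exact: cvg_cancels.
Qed.

Lemma zero_repsP s : zero_reps delta A s <-> cancels 0 s.
Proof. by rewrite cancelsP oppr0. Qed.

Lemma cancels_inj y z s : cancels y s -> cancels z s -> y = z.
Proof.
move=> /cancelsP[_ sy] /cancelsP[_ sz].
by apply: oppr_inj; apply: (cvg_unique _ sy sz).
Qed.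

Lemma value_wcat y w s n :
  value y (mkseq (wcat w s) (size w + n)) = value (value y w) (mkseq s n).
Proof. by rewrite mkseq_wcat value_cat. Qed.

Lemma cancels_wcat y w s : fin_words A w -> inf_words A s ->
  cancels y (wcat w s) <-> cancels (value y w) s.
Proof.
move=> wA sA; have wsA := inf_words_wcat wA sA.
split=> -[_ sy]; split=> // n; first by rewrite -value_wcat.
pose m := (size w + n)%N.
have mE : mkseq (wcat w s) m =
    mkseq (wcat w s) n ++ drop n (mkseq (wcat w s) m).
  rewrite -[LHS](cat_take_drop n); congr (_ ++ _).
  by rewrite /mkseq -map_take take_iota (minn_idPl _)// leq_addl.
apply: (@le_norm_value R0 _ (drop n (mkseq (wcat w s) m))) => //.
  by move=> x /mem_drop; apply: fin_words_mkseq.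
by rewrite -value_cat -mE value_wcat.
Qed.

(** A common continuation [s] represents the opposite of both values. *)
Lemma right_congr_value a b s : fin_words A a -> fin_words A b ->
  right_congr delta A a b -> cancels (value 0 a) s -> value 0 b = value 0 a.
Proof.
move=> aA bA ab as0; have sA := as0.1.
apply: (cancels_inj _ as0); apply/(cancels_wcat 0 bA sA)/zero_repsP/ab => //.
by apply/zero_repsP; apply/(cancels_wcat 0 aA sA).
Qed.

(** * Cancellable values and Koenig's lemma *)

Definition cancellable y := exists s, cancels y s.

(** The tree of words whose value from [y] stays in the disc of radius [r] is
    infinite. Asking for words of size at least [n] is enough, because for
    [r >= R0] this tree is closed under prefixes, by [le_norm_value]. *)
Definition long_words r y := forall n,
  exists2 w, fin_words A w & (n <= size w)%N && (`|value y w| <= r).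

(** The pigeonhole step of Koenig's lemma: if all subtrees at the letters of [A]
    had bounded height, so would the whole tree. *)
Lemma long_words_step r y : long_words r y ->
  exists2 x, x \in A & long_words r (y * delta + x).
Proof.
move=> ly; apply: contrapT => /forall2NP nx.
have /choice[N NP] : forall x, exists n, x \in A ->
    forall w, fin_words A w -> `|value (y * delta + x) w| <= r -> (size w < n)%N.
  move=> x; have [//|/existsNP[n np]] := nx x; first by exists 0%N.
  exists n => _ w wA wr; rewrite ltnNge; apply/negP => nw; apply: np.
  by exists w => //; rewrite nw.
(* one letter more than the largest bound for the subtrees *)
have [[|x w] wA /andP[/= wn wr]] := ly (\max_(x <- A) N x).+1 => //.
have [xA wA'] := (fin_words_cons A x w).1 wA.
have := NP x xA w wA' wr; rewrite ltnNge => /negP; apply.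
by rewrite -ltnS; apply: leq_trans wn; rewrite ltnS; apply: leq_bigmax_seq.
Qed.

(** Koenig's lemma: iterating [long_words_step] gives an infinite branch, along
    which the values stay bounded. *)
Lemma long_words_cancellable r y : R0 <= r -> long_words r y -> cancellable y.
Proof.
move=> Rr ly.
have /choice[f fP] : forall z, exists x,
    long_words r z -> x \in A /\ long_words r (z * delta + x).
  move=> z; have [/long_words_step[x xA lx]|] := pselect (long_words r z).
    by exists x.
  by exists 0.
pose t n := iter n (fun z => z * delta + f z) y.
have lt n : long_words r (t n) by elim: n => [//|n /fP[]].
have tE n : value y (mkseq (f \o t) n) = t n.
  by elim: n => [//|n IH]; rewrite value_mkseqS IH.
exists (f \o t); apply/cancelsP; split=> [n|]; first by have [] := fP _ (lt n).
apply: (@bounded_trajectory_cvg r) => n; rewrite tE.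
have [w wA /andP[_ wr]] := lt n 0%N.
exact: le_norm_value wr.
Qed.

Definition descendants y : set K := value y @` fin_words A.

(** The tree of the words that lead from [y] into the disc has bounded height,
    since [y] is not cancellable. *)
Lemma finite_descendants_ball r y : R0 <= r -> ~ cancellable y ->
  finite_set (descendants y `&` [set z | `|z| <= r]).
Proof.
move=> Rr /(contra_not (long_words_cancellable Rr)) /existsNP[n np].
apply: sub_finite_set (finite_image (value y) (finite_fin_words_size A n)).
move=> _ [[w wA <-] /= wr]; exists w => //; split=> //.
rewrite leqNgt; apply/negP => /ltnW nw; apply: np; exists w => //.
by rewrite nw.
Qed.

Definition cancellable_values : set K := descendants 0 `&` cancellable.

(** A word with a non-cancellable value has a first prefix from which all values
    are non-cancellable; this prefix is empty or adds one letter to a cancellable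
    value. The possible values at that moment form the finite set [roots], and
    [finite_descendants_ball] applies to each of them. *)
Lemma finite_spectrum_ball r : R0 <= r -> finite_set cancellable_values ->
  finite_set (descendants 0 `&` [set z | `|z| <= r]).
Proof.
move=> Rr finC.
pose roots := ([set 0] `|`
  image2 cancellable_values [set` A] (fun z x => z * delta + x)) `\` cancellable.
have finr : finite_set roots.
  apply: finite_setD; rewrite finite_setU; split; first exact: finite_set1.
  exact: finite_image2.
have fin : finite_set (cancellable_values `|`
    \bigcup_(y in roots) (descendants y `&` [set z | `|z| <= r])).
  rewrite finite_setU; split=> //; apply: bigcup_finite => // y [_ ny].
  exact: finite_descendants_ball.
apply: sub_finite_set fin => _ [[w wA <-] wr].
suff : (cancellable_values `|` \bigcup_(y in roots) descendants y) (value 0 w).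
  by move=> [?|[y ry yw]]; [left|right; exists y].
elim/last_ind: w wA {wr} => [|w x IH] wxA.
  have [c0|nc0] := pselect (cancellable 0); first by left; split=> //; exists [::].
  by right; exists 0; [split=> //; left | exists [::]].
have [c|nc] := pselect (cancellable (value 0 (rcons w x))).
  by left; split=> //; exists (rcons w x).
have [wA xA] : fin_words A w /\ x \in A.
  by split=> [z zw|]; apply: wxA; rewrite mem_rcons inE ?zw ?eqxx ?orbT.
right; have [cw|[y ry [u uA uw]]] := IH wA.
  exists (value 0 (rcons w x)); last by exists [::].
  split=> //; right; rewrite value_rcons.
  by exists (value 0 w) => //; exists x.
exists y => //; exists (rcons u x); last by rewrite !value_rcons uw.
by move=> z; rewrite mem_rcons inE => /orP[/eqP->//|/uA].
Qed.

Lemma spectrumE : spectrum delta A = descendants 0.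
Proof.
have vE y w : value y w =
    y * delta ^+ size w + \sum_(n < size w) w`_n * delta ^+ (size w - 1 - n).
  elim: w y => [|x w IH] y /=; first by rewrite big_ord0 mulr1 addr0.
  rewrite IH big_ord_recl /= subSS !subn0 mulrDl exprS mulrA addrA.
  congr (_ + _); apply: eq_bigr => i _; rewrite /bump /= add1n.
  by rewrite -subnDA add1n.
by apply/seteqP; split=> _ [w wA <-]; exists w => //; rewrite vE mul0r add0r.
Qed.

(** * The spectrum has no accumulation point *)

(** By [right_congr_value], the class of a word with cancellable value determines
    this value. *)
Lemma finite_cancellable_values :
  finite_set (right_congr_classes delta A) -> finite_set cancellable_values.
Proof.
move=> finR.
pose D := fin_words A `&` [set a | cancellable (value 0 a)].
pose cls a := [set b | fin_words A b /\ right_congr delta A a b].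
have -> : cancellable_values = value 0 @` D.
  apply/seteqP; split=> [_ [[w wA <-] c]|_ [w [wA c] <-]]; first by exists w.
  by split=> //; exists w.
apply: (@finite_factor _ _ _ _ cls) => [a b [aA [s as0]] [bA _] ab|].
  apply/esym; apply: (right_congr_value aA bA _ as0).
  have : cls b b by split=> // s' _.
  by rewrite -ab => -[].
by apply: sub_finite_set finR => _ [a [aA _] <-]; exists a.
Qed.

Lemma finite_ball_limit_point (S : set K) :
  (forall p, exists2 e, 0 < e & finite_set (S `&` ball p e)) ->
  limit_point S = set0.
Proof.
move=> fin; apply/seteqP; split=> // p /= lp.
have [e e0 fe] := fin p.
have nb : nbhs p (ball p e `&` ~` ((S `&` ball p e) `\ p)).
  apply: filterI; first exact: nbhsx_ballx.
  apply: open_nbhs_nbhs; split; last by case=> _; apply.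
  have [closedP _] := @accessible_finite_set_closed K.
  apply: closed_openC; apply: closedP; last exact: finite_setD.
  exact/hausdorff_accessible/norm_hausdorff.
have [z [zp Sz [bz nz]]] := lp _ nb.
by apply: nz; split=> //; apply/eqP.
Qed.

Lemma limit_point_spectrum : finite_set (right_congr_classes delta A) ->
  limit_point (spectrum delta A) = set0.
Proof.
move=> /finite_cancellable_values fin; apply: finite_ball_limit_point => p.
exists 1 => //; rewrite spectrumE.
(* a disc around 0 that contains the unit disc around p *)
have Rr : R0 <= R0 + (`|p| + 1) by rewrite lerDl addr_ge0.
apply: sub_finite_set (finite_spectrum_ball Rr fin) => z [dz].
rewrite -ball_normE /= => pz; split=> //=.
apply: ler_wpDl; first exact: radius_ge0.
rewrite -[z](subrK p) (le_trans (ler_normD _ _))// addrC lerD2l.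
by rewrite distrC ltW.
Qed.

(** * The zero automaton *)

Lemma accepted_set_zero_automaton :
  accepted_set (zero_automaton delta A) = zero_reps delta A.
Proof.
apply/seteqP; split=> s.
  move=> [p [/= p0 pE _]]; apply/zero_repsP.
  have vE n : value 0 (mkseq s n) = set_val (p n).
    elim: n => [|n IH]; first by rewrite p0.
    by rewrite value_mkseqS IH; have [_ /= ->] := pE n.
  split=> n; first by have [] := pE n.
  by rewrite vE; have [] := set_valP (p n).
move=> /zero_repsP[sA sb].
have qP n : zero_states delta A (value 0 (mkseq s n)).
  by split; [rewrite spectrumE; exists (mkseq s n) => //; exact: fin_words_mkseq | exact: sb].
exists (fun n => SigSub (mem_set (qP n))); split=> [|n|] //=.
- split; first exact: sA.
  exact: value_mkseqS.
- rewrite (_ : [set n | _] = setT); first exact: infinite_nat.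
  by apply/seteqP.
Qed.

Lemma finite_zero_automaton :
  finite_set (zero_states delta A) -> finite_buchi (zero_automaton delta A).
Proof.
move=> fin; rewrite /finite_buchi /=.
apply: (sub_finite_set _ (@finite_preimage _ _ _ set_val (in2W val_inj) fin)).
by move=> z _; apply: set_valP.
Qed.

End trajectories.

(** * From a finite automaton to finitely many classes *)

Lemma finite_right_congr_classes (K : numFieldType) (delta : K) (A : {fset K})
    (M : buchi K) : finite_buchi M -> accepted_set M = zero_reps delta A ->
  finite_set (right_congr_classes delta A).
Proof.
move=> finM ME.
pose reach := foldl (@successors _ M) (@initial _ M).
have accE w s : zero_reps delta A (wcat w s) <-> accepts_from (reach w) s.
  by rewrite -ME -accepts_from_wcat.
apply: (@finite_factor _ _ _ _ reach) => [a b _ _ ab|].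
  by apply/seteqP; split=> c [cA ac]; split=> // s sA;
    rewrite -ac// !accE ab.
by apply: sub_finite_set (finite_set_of_sets finM).
Qed.

(** * Sets without accumulation point *)

(** If [S] were infinite, the subsets of [T] that contain all but finitely many elements of
    [S] would form a proper filter containing [C], and a cluster point of this
    filter would be a limit point of [S]. *)
Lemma compact_finite (T : topologicalType) (C S : set T) :
  compact C -> S `<=` C -> limit_point S = set0 -> finite_set S.
Proof.
move=> cC SC nolim; apply: contrapT => infS.
pose F : set_system T := fun U => finite_set (S `\` U).
have FF : ProperFilter F.
  split; first by rewrite /F setD0.
  split=> [|U V FU FV|U V UV]; rewrite /F.
  - by rewrite setDT.
  - by rewrite setDIr finite_setU.
  - by apply: sub_finite_set => x [Sx nV]; split=> // /UV.
have FC : F C by rewrite /F (_ : _ `\` _ = set0)// setD_eq0.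
have [p [_ Fp]] := cC F FF FC.
have /existsNP[U /not_implyP[pU nU]] : ~ limit_point S p by rewrite nolim.
have FU : F (~` U).
  apply: (sub_finite_set _ (finite_set1 p)) => y [Sy /contrapT Uy] /=.
  by apply: contrapT => /eqP yp; apply: nU; exists y.
by have [y []] := Fp _ _ FU pU.
Qed.

Lemma limit_point0_isolated (K : numFieldType) (S : set K) :
  limit_point S = set0 -> forall p, exists2 e : K, 0 < e &
    forall z, S z -> `|p - z| < e -> z = p.
Proof.
move=> nolim p; have /existsNP[U /not_implyP[pU nU]] : ~ limit_point S p.
  by rewrite nolim.
have [e e0 eU] := (nbhs_ballP _ _).1 pU.
exists e => // z Sz pz; apply: contrapT => /eqP zp; apply: nU; exists z.
by split=> //; apply: eU; rewrite -ball_normE.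
Qed.

(** * The complex plane *)

Section complex_numbers.
Variable R : realType.
Implicit Types (z : R[i]).

Lemma gt0_complexP (e : R[i]) : 0 < e -> exists2 e' : R, 0 < e' & e = e'%:C%C.
Proof.
move=> e0; exists (complex.Re e); last by rewrite RRe_real// gtr0_real.
by move: e0; rewrite ltcE /= => /andP[].
Qed.

Lemma complex_powers_small (delta : R[i]) : 1 < `|delta| ->
  forall e : R[i], 0 < e ->
  exists N, forall n, (N <= n)%N -> `|delta ^- n| < e.
Proof.
move=> d1 _ /gt0_complexP[e e0 ->].
have [r rE] : exists r : R, `|delta| = r%:C%C by rewrite normc_def; eexists.
move: d1; rewrite rE ltcR => r1.
have r0 : 0 < r by apply: lt_trans r1.
have rV : `|r^-1| < 1 by rewrite ger0_norm ?invr_ge0 ?ltW// invf_lt1.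
have := cvg_geometric 1 rV => /cvgrPdist_lt/(_ _ e0)[N _ NP].
exists N => n /NP /=; rewrite mul1r sub0r normrN ger0_norm ?exprn_ge0 ?invr_ge0 ?ltW//.
by rewrite normfV normrX rE exprVn -ltcR !(rmorphV, rmorphXn)// unitfE expf_neq0 ?gt_eqF.
Qed.

(** The set is transported to the square of side [2 * t] in [R * R], whose
    compactness comes from that of segments. *)
Lemma finite_ball (S : set (R[i] : numFieldType)) (r : R[i]) :
  limit_point S = set0 -> finite_set (S `&` [set z | `|z| <= r]).
Proof.
move=> /limit_point0_isolated iso.
have [r0|nr0] := boolP (0 <= r); last first.
  rewrite (_ : _ `&` _ = set0)//; apply/seteqP; split=> // z [_ /= zr].
  by move/negP: nr0; apply; apply: le_trans zr.
pose t := complex.Re r.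
have rE : r = t%:C%C by rewrite RRe_real// ger0_real.
pose g (p : R * R) : R[i] := (p.1 +i* p.2)%C.
pose C : set (R * R) := `[- t, t]%classic `*` `[- t, t]%classic.
have cC : compact C by apply: compact_setX; apply: segment_compact.
have fin : finite_set (C `&` g @^-1` S).
  apply: (compact_finite cC) => [p []//|]; apply/seteqP; split=> // p /= lp.
  have [_ /gt0_complexP[e e0 ->] eP] := iso (g p).
  have := lp _ (nbhsx_ballx p _ (divr_gt0 e0 (ltr0n _ 2))).
  move=> [q [/eqP qp [_ Sq] [pq1 pq2]]]; apply: qp.
  suff : g q = g p by case: (q) => ? ?; case: (p) => ? ? [-> ->].
  apply: eP => //.
  move: p q pq1 pq2 {lp Sq} => [a b] [c d] /= ac bd.
  rewrite normc_def /= ltcR -[ltRHS]gtr0_norm// -sqrtr_sqr.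
  rewrite ltr_sqrt ?exprn_gt0//.
  move: ac bd; rewrite /ball /= !ltr_norml => /andP[? ?] /andP[? ?].
  nra.
apply: sub_finite_set (finite_image g fin) => z [Sz /= zr].
exists (complex.Re z, complex.Im z); last by case: (z).
split; last by case: (z) Sz.
have : Num.sqrt (complex.Re z ^+ 2 + complex.Im z ^+ 2) <= t.
  by rewrite -lecR -rE -normc_def.
move=> zt; split=> /=; rewrite in_itv /= -ler_norml -sqrtr_sqr.
  by apply: le_trans zt; rewrite ler_wsqrtr// lerDl sqr_ge0.
by apply: le_trans zt; rewrite ler_wsqrtr// lerDr sqr_ge0.
Qed.

End complex_numbers.

(** * The equivalence *)

Theorem theorem8 (R : realType) (delta : R[i]) (A : {fset R[i]})
    (hdelta : 1 < `|delta|) (hA : A != fset0) :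
  [<->
    (* 1 *) exists2 M : buchi R[i],
              finite_buchi M & accepted_set M = zero_reps delta A;
    (* 2 *) finite_set (right_congr_classes delta A);
    (* 3 *) limit_point (spectrum delta A) = set0;
    (* 4 *) finite_buchi (zero_automaton delta A)].
Proof.
have powers := complex_powers_small hdelta.
tfae.
- by move=> [M finM ME]; apply: finite_right_congr_classes finM ME.
- exact: limit_point_spectrum.
- by move=> nolim; apply/finite_zero_automaton/finite_ball.
- move=> fin; exists (zero_automaton delta A) => //.
  exact: accepted_set_zero_automaton.
Qed.
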